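(* Let $\mathbf{k}$ be a commutative ring and let $L$ be a free $\mathbf{k}$-module. Then $\mathfrak{h}^{\star} = \operatorname{Ker}\mathbf{t}$.
   Context: Let $\mathbb{N}=\{0,1,2,\ldots\}$; all tensor products are over $\mathbf{k}$. $T(L)=\bigoplus_{n\in\mathbb{N}} L^{\otimes n}$ is the tensor algebra of $L$ (product = concatenation of tensors), graded with $L^{\otimes n}$ in degree $n$; $L$ is identified with $L^{\otimes 1}$. $\mathbf{t}:T(L)\to T(L)$ is the $\mathbf{k}$-linear map given by $\mathbf{t}(u_1\otimes u_2\otimes\cdots\otimes u_k)=\sum_{i=1}^{k}(-1)^{i-1}u_i\otimes u_1\otimes u_2\otimes\cdots\otimes\widehat{u_i}\otimes\cdots\otimes u_k$ for all $k\in\mathbb{N}$ and $u_1,\ldots,u_k\in L$, where $\widehat{u_i}$ means that the factor $u_i$ is omitted from its usual place (so $\mathbf{t}$ is $0$ on $L^{\otimes 0}$). The supercommutator $[\cdot,\cdot]_{\mathrm{s}}:T(L)\times T(L)\to T(L)$ is the $\mathbf{k}$-bilinear map with $[U,V]_{\mathrm{s}}=UV-(-1)^{nm}VU$ for $U\in L^{\otimes n}$, $V\in L^{\otimes m}$. For $\mathbf{k}$-submodules $A,B$ of $T(L)$, $[A,B]_{\mathrm{s}}$ denotes the $\mathbf{k}$-linear span of all $[U,V]_{\mathrm{s}}$ with $U\in A$, $V\in B$. Define $\mathbf{k}$-submodules $L_1,L_2,L_3,\ldots$ of $T(L)$ recursively by $L_1=L$ and $L_{i+1}=[L,L_i]_{\mathrm{s}}$.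 Let $\overline{\mathfrak{g}}=L_2+L_3+L_4+\cdots$. Let $P$ be the $\mathbf{k}$-submodule of $L^{\otimes 2}$ spanned by all $x\otimes x$ with $x\in L$. Let $\mathfrak{h}=\overline{\mathfrak{g}}+P$. For a $\mathbf{k}$-submodule $U$ of a $\mathbf{k}$-algebra $A$, $U^{\star}=U^0+U^1+U^2+\cdots$ denotes the $\mathbf{k}$-subalgebra of $A$ generated by $U$, where $U^i=UU\cdots U$ ($i$ factors) and $U^0=\mathbf{k}\cdot 1_A$. *)

(* Defs.v *)
From HB Require Import structures.
From mathcomp Require Import all_boot all_algebra.
From mathcomp Require Import boolp classical_sets.

Set Implicit Arguments.
Unset Strict Implicit.
Unset Printing Implicit Defensive.

Import GRing.Theory.
Import quotient.
Local Open Scope quotient_scope.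
Local Open Scope ring_scope.
Local Open Scope classical_set_scope.

(* Modules and submodules: a submodule of M is represented by its underlying  *)
(* set.  The base ring k may be the zero ring, which is why algebras below    *)
(* are not algType (MathComp requires 1 != 0 there).                          *)

Section Submodules.
Variables (k : comPzRingType) (M : lmodType k).
Implicit Types A B : set M.

Definition span A : set M :=
  [set x | exists2 s : seq (k * M),
             (forall p, p \in s -> A p.2) & x = \sum_(p <- s) p.1 *: p.2].

Definition addsub A B : set M := [set a + b | a in A & b in B].

(* A 0 + A 1 + A 2 + ... *)
Definition sumsub (A : nat -> set M) : set M :=
  [set x | exists (n : nat) (f : nat -> M),
             (forall i, A i (f i)) /\ x = \sum_(i < n) f i].

Definition lin_indep B : Prop :=
  forall (s : seq M) (c : M -> k),
    uniq s -> (forall x, x \in s -> B x) ->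
    \sum_(x <- s) c x *: x = 0 -> forall x, x \in s -> c x = 0.

Definition is_basis B : Prop := span B = setT /\ lin_indep B.

Definition is_free_module : Prop := exists B : set M, is_basis B.

End Submodules.

Arguments is_free_module {k} M.

(* The tensor algebra.  A word w = [:: u_1; ...; u_n] over L stands for the   *)
(* pure tensor u_1 (x) ... (x) u_n, and a sequence of pairs (c, w) for the    *)
(* formal sum of the c w.  The k-module of formal sums modulo the             *)
(* multilinearity relations is the direct sum over n of (free module on L^n)  *)
(* / (multilinearity), i.e. of the tensor powers of L.                        *)

Section TensorAlgebra.
Variables (k : comPzRingType) (L : lmodType k).

Definition fsum : Type := seq (k * seq L).

Inductive tcong : fsum -> fsum -> Prop :=
| tcong_refl s : tcong s s
| tcong_sym s t : tcong s t -> tcong t s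
| tcong_trans s t r : tcong s t -> tcong t r -> tcong s r
| tcong_cat s s' t t' :
    tcong s s' -> tcong t t' -> tcong (s ++ t) (s' ++ t')
| tcong_catC s t : tcong (s ++ t) (t ++ s)
| tcong_coef0 w : tcong [:: (0, w)] [::]
| tcong_coefD c d w : tcong [:: (c + d, w)] [:: (c, w); (d, w)]
| tcong_tensD c a x y b :
    tcong [:: (c, a ++ (x + y) :: b)] [:: (c, a ++ x :: b); (c, a ++ y :: b)]
| tcong_tensZ c d a x b :
    tcong [:: (c, a ++ (d *: x) :: b)] [:: (c * d, a ++ x :: b)].

Definition tcongb : rel fsum := fun s t => `[< tcong s t >].

Lemma tcongb_refl : reflexive tcongb.
Proof. by move=> s; apply/asboolP; exact: tcong_refl. Qed.

Lemma tcongb_sym : symmetric tcongb.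
Proof.
by move=> s t; apply/idP/idP => /asboolP h; apply/asboolP; exact: tcong_sym.
Qed.

Lemma tcongb_trans : transitive tcongb.
Proof.
by move=> t s r /asboolP h1 /asboolP h2; apply/asboolP; exact: tcong_trans h2.
Qed.

Canonical tcong_equiv := EquivRel tcongb tcongb_refl tcongb_sym tcongb_trans.

Definition tensalg : Type := {eq_quot tcongb}.
HB.instance Definition _ : EqQuotient fsum tcongb tensalg :=
  EqQuotient.on tensalg.
HB.instance Definition _ := Choice.on tensalg.

Definition cls (s : fsum) : tensalg := \pi_tensalg s.

Lemma clsP s t : cls s = cls t <-> tcong s t.
Proof.
split=> [/eqmodP h | h]; first exact/asboolP.
by apply/eqmodP; exact/asboolP.
Qed.

Lemma cls_repr (x : tensalg) : cls (repr x) = x.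
Proof. exact: reprK. Qed.

Lemma tcong_repr s : tcong (repr (cls s)) s.
Proof. by apply/clsP; rewrite cls_repr. Qed.

Definition fscale (c : k) (s : fsum) : fsum := [seq (c * p.1, p.2) | p <- s].

Lemma tcong_fscale c s t : tcong s t -> tcong (fscale c s) (fscale c t).
Proof.
elim=> {s t}.
- by move=> s; exact: tcong_refl.
- by move=> s t _; exact: tcong_sym.
- by move=> s t r _ h1 _ h2; exact: tcong_trans h2.
- by move=> s s' t t' _ h1 _ h2; rewrite /fscale !map_cat; exact: tcong_cat.
- by move=> s t; rewrite /fscale !map_cat; exact: tcong_catC.
- by move=> w; rewrite /= mulr0; exact: tcong_coef0.
- by move=> d e w; rewrite /= mulrDr; exact: tcong_coefD.
- by move=> d a x y b; exact: tcong_tensD.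
- by move=> d e a x b; rewrite /= mulrA; exact: tcong_tensZ.
Qed.

Definition tzero : tensalg := cls [::].
Definition tadd (x y : tensalg) : tensalg := cls (repr x ++ repr y).
Definition tscale (c : k) (x : tensalg) : tensalg := cls (fscale c (repr x)).
Definition topp (x : tensalg) : tensalg := tscale (-1) x.

Lemma tadd_cls s t : tadd (cls s) (cls t) = cls (s ++ t).
Proof. by apply/clsP; apply: tcong_cat; exact: tcong_repr. Qed.

Lemma tscale_cls c s : tscale c (cls s) = cls (fscale c s).
Proof. by apply/clsP; apply: tcong_fscale; exact: tcong_repr. Qed.

Lemma taddA : associative tadd.
Proof.
move=> x y z; rewrite -(cls_repr x) -(cls_repr y) -(cls_repr z).
by rewrite !tadd_cls catA.
Qed.

Lemma taddC : commutative tadd.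
Proof.
move=> x y; rewrite -(cls_repr x) -(cls_repr y) !tadd_cls.
by apply/clsP; exact: tcong_catC.
Qed.

Lemma tadd0 : left_id tzero tadd.
Proof. by move=> x; rewrite -(cls_repr x) tadd_cls. Qed.

Lemma tscaleDl x c d : tscale (c + d) x = tadd (tscale c x) (tscale d x).
Proof.
rewrite -(cls_repr x) !tscale_cls.
elim: (repr x) => [|[e w] s ih] /=; first by rewrite tadd0.
have eD : cls [:: (c * e + d * e, w)] = cls [:: (c * e, w); (d * e, w)].
  by apply/clsP; exact: tcong_coefD.
rewrite -cat1s -tadd_cls ih mulrDl eD.
rewrite -[_ :: fscale c s]cat1s -[_ :: fscale d s]cat1s -[_ :: [:: _]]cat1s.
rewrite -!tadd_cls -!taddA; congr tadd.
by rewrite taddA [in RHS]taddA; congr tadd; exact: taddC.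
Qed.

Lemma tscale0 x : tscale 0 x = tzero.
Proof.
rewrite -(cls_repr x) tscale_cls; apply/clsP.
elim: (repr x) => [|[e w] s ih] /=; first exact: tcong_refl.
rewrite mul0r -cat1s -[[::]]/([::] ++ [::]).
by apply: tcong_cat ih; exact: tcong_coef0.
Qed.

Lemma tscale1 : left_id 1 tscale.
Proof.
move=> x; rewrite -{2}(cls_repr x) -[in LHS](cls_repr x) tscale_cls.
by congr cls; rewrite -[RHS]map_id; apply: eq_map => -[e w] /=; rewrite mul1r.
Qed.

Lemma taddN : left_inverse tzero topp tadd.
Proof.
by move=> x; rewrite -{2}(tscale1 x) /topp -tscaleDl addNr tscale0.
Qed.

Lemma tscaleA c d x : tscale c (tscale d x) = tscale (c * d) x.
Proof.
rewrite -(cls_repr x) !tscale_cls /fscale -map_comp; congr cls.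
by apply: eq_map => -[e w] /=; rewrite mulrA.
Qed.

Lemma tscaleDr : right_distributive tscale tadd.
Proof.
move=> c x y; rewrite -(cls_repr x) -(cls_repr y).
by rewrite !(tadd_cls, tscale_cls) /fscale map_cat.
Qed.

HB.instance Definition _ := GRing.isZmodule.Build tensalg
  taddA taddC tadd0 taddN.
HB.instance Definition _ := GRing.Zmodule_isLmodule.Build k tensalg
  tscaleA tscale1 tscaleDr tscaleDl.

Lemma clsD s t : cls s + cls t = cls (s ++ t).
Proof. exact: tadd_cls. Qed.

Lemma clsZ c s : c *: cls s = cls (fscale c s).
Proof. exact: tscale_cls. Qed.

(* The pure tensor u_1 (x) ... (x) u_n of the word [:: u_1; ...; u_n]. *)
Definition tens (w : seq L) : tensalg := cls [:: (1, w)].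

Lemma clsE s : cls s = \sum_(p <- s) p.1 *: tens p.2.
Proof.
elim: s => [|[c w] s ih]; first by rewrite big_nil.
rewrite big_cons -ih -cat1s -clsD; congr (_ + _) => /=.
by rewrite /tens clsZ /= mulr1.
Qed.

Lemma tensalg_ind (P : tensalg -> Prop) :
  P 0 -> (forall c w x, P x -> P (c *: tens w + x)) -> forall x, P x.
Proof.
move=> P0 PD x; rewrite -(cls_repr x) clsE.
by elim: (repr x) => [|p s ih]; rewrite ?big_nil ?big_cons //; exact: PD.
Qed.

(* Linear maps out of the tensor algebra are given by maps on words that are  *)
(* linear in each letter; lift is independent of the representative by        *)
(* lift_cls.                                                                  *)
Definition multilinear (M : lmodType k) (phi : seq L -> M) : Prop :=
  forall (c : k) a x y b,
    phi (a ++ (c *: x + y) :: b) = c *: phi (a ++ x :: b) + phi (a ++ y :: b).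

Definition lift (M : lmodType k) (phi : seq L -> M) (x : tensalg) : M :=
  \sum_(p <- repr x) p.1 *: phi p.2.

Section Lift.
Variables (M : lmodType k) (phi : seq L -> M).
Hypothesis phiP : multilinear phi.

Lemma multilinear0 a b : phi (a ++ 0 :: b) = 0.
Proof.
have := phiP 1 a 0 0 b; rewrite !scale1r addr0 => h.
by apply: (addrI (phi (a ++ 0 :: b))); rewrite -h addr0.
Qed.

Lemma lift_cls s : lift phi (cls s) = \sum_(p <- s) p.1 *: phi p.2.
Proof.
rewrite /lift; have := tcong_repr s; move: (repr _) => r.
elim=> {r s} //.
- by move=> s t r _ -> _.
- by move=> s s' t t' _ h1 _ h2; rewrite !big_cat /= h1 h2.
- by move=> s t; rewrite !big_cat /= addrC.
- by move=> w; rewrite big_seq1 big_nil scale0r.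
- by move=> c d w; rewrite big_seq1 big_cons big_seq1 scalerDl.
- move=> c a x y b; rewrite big_seq1 big_cons big_seq1 /=.
  by rewrite -scalerDr; have := phiP 1 a x y b; rewrite !scale1r => ->.
- move=> c d a x b; rewrite !big_seq1 /= -scalerA.
  by have := phiP d a x 0 b; rewrite multilinear0 !addr0 => ->.
Qed.

Lemma lift_tens w : lift phi (tens w) = phi w.
Proof. by rewrite lift_cls big_seq1 scale1r. Qed.

Lemma lift_is_linear : linear (lift phi).
Proof.
move=> c x y; rewrite -(cls_repr x) -(cls_repr y).
rewrite clsZ clsD !lift_cls big_cat big_map scaler_sumr; congr (_ + _).
by apply: eq_bigr => p _ /=; rewrite scalerA.
Qed.

End Lift.

Lemma tens_multilinear : multilinear tens.
Proof.
move=> c a x y b; rewrite /tens clsZ clsD; apply/clsP => /=.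
apply: tcong_trans (tcong_tensD _ _ _ _ _) _.
rewrite -[_ :: _]cat1s -[X in tcong _ X]cat1s.
apply: tcong_cat; last exact: tcong_refl.
apply: tcong_trans (tcong_tensZ _ _ _ _ _) _.
by rewrite mul1r mulr1; exact: tcong_refl.
Qed.

(* Bilinear extension to the tensor algebra of a map on pairs of words. *)
Definition lift2 (f : seq L -> seq L -> tensalg) (x y : tensalg) : tensalg :=
  lift (fun u => lift (f u) y) x.

Section Lift2.
Variable f : seq L -> seq L -> tensalg.
Hypothesis fr : forall u, multilinear (f u).
Hypothesis fl : forall v, multilinear (f^~ v).

Lemma lift2_multilinear y : multilinear (fun u => lift (f u) y).
Proof.
move=> c a x x' b; elim/tensalg_ind: y => [|d w y ih].
  have h u : lift (f u) 0 = 0 by have := lift_cls (fr u) [::]; rewrite big_nil.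
  by rewrite !h scaler0 addr0.
rewrite !(lift_is_linear (fr _)) !(lift_tens (fr _)) ih fl.
by rewrite !scalerDr !scalerA mulrC addrACA.
Qed.

Lemma lift2_tens u v : lift2 f (tens u) (tens v) = f u v.
Proof.
by rewrite /lift2 (lift_tens (lift2_multilinear _)) (lift_tens (fr u)).
Qed.

Lemma lift2_linearl y : linear (fun x => lift2 f x y).
Proof. exact: lift_is_linear (lift2_multilinear y). Qed.

Lemma lift2_linearr x : linear (lift2 f x).
Proof.
move=> c y z; rewrite /lift2 /lift scaler_sumr -big_split /=.
apply: eq_bigr => p _.
by rewrite -!/(lift _ _) (lift_is_linear (fr _)) scalerDr !scalerA mulrC.
Qed.

End Lift2.

Definition tmul : tensalg -> tensalg -> tensalg :=
  lift2 (fun u v => tens (u ++ v)).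
Definition tone : tensalg := tens [::].

Lemma tcat_multilinearr u : multilinear (fun v => tens (u ++ v)).
Proof. by move=> c a x y b; rewrite !catA tens_multilinear. Qed.

Lemma tcat_multilinearl v : multilinear (fun u => tens (u ++ v)).
Proof. by move=> c a x y b; rewrite -!catA !cat_cons tens_multilinear. Qed.

Let tmull := lift2_linearl tcat_multilinearr tcat_multilinearl.
Let tmulr := lift2_linearr tcat_multilinearr.

Lemma tmul_tens u v : tmul (tens u) (tens v) = tens (u ++ v).
Proof. exact: (lift2_tens tcat_multilinearr tcat_multilinearl). Qed.

Lemma tmulDl : left_distributive tmul +%R.
Proof. by move=> x y z; have := tmull z 1 x y; rewrite !scale1r. Qed.

Lemma tmulDr : right_distributive tmul +%R.
Proof. by move=> x y z; have := tmulr x 1 y z; rewrite !scale1r. Qed.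

Lemma tmul0 x : tmul x 0 = 0.
Proof. by apply: (addrI (tmul x 0)); rewrite -tmulDr !addr0. Qed.

Lemma t0mul x : tmul 0 x = 0.
Proof. by apply: (addrI (tmul 0 x)); rewrite -tmulDl !addr0. Qed.

Lemma tscaleAl c x y : c *: tmul x y = tmul (c *: x) y.
Proof. by have := tmull y c x 0; rewrite /= -!/(tmul _ _) t0mul !addr0. Qed.

Lemma tscaleAr c x y : c *: tmul x y = tmul x (c *: y).
Proof. by have := tmulr x c y 0; rewrite /= -!/(tmul _ _) tmul0 !addr0. Qed.

Lemma tmulA : associative tmul.
Proof.
move=> x y z; elim/tensalg_ind: x => [|c u x ihx]; first by rewrite !t0mul.
rewrite !tmulDl -{}ihx -!tscaleAl; congr (_ *: _ + _).
elim/tensalg_ind: y => [|d v y ihy]; first by rewrite tmul0 !t0mul tmul0.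
rewrite !(tmulDl, tmulDr) -{}ihy -!tscaleAl -!tscaleAr -!tscaleAl.
congr (_ *: _ + _).
elim/tensalg_ind: z => [|e w z ihz]; first by rewrite !tmul0.
by rewrite !tmulDr -ihz -!tscaleAr !tmul_tens catA.
Qed.

Lemma t1mul : left_id tone tmul.
Proof.
elim/tensalg_ind => [|c w x ih]; first by rewrite tmul0.
by rewrite tmulDr ih -tscaleAr tmul_tens.
Qed.

Lemma tmul1 : right_id tone tmul.
Proof.
elim/tensalg_ind => [|c w x ih]; first by rewrite t0mul.
by rewrite tmulDl ih -tscaleAl tmul_tens cats0.
Qed.

HB.instance Definition _ := GRing.Zmodule_isPzRing.Build tensalg
  tmulA t1mul tmul1 tmulDl tmulDr.

Lemma tensM u v : tens u * tens v = tens (u ++ v).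
Proof. exact: tmul_tens. Qed.

Lemma tensalg_scaleAl c (x y : tensalg) : c *: (x * y) = (c *: x) * y.
Proof. exact: tscaleAl. Qed.

Lemma tensalg_scaleAr c (x y : tensalg) : c *: (x * y) = x * (c *: y).
Proof. exact: tscaleAr. Qed.

(* The n-th tensor power of L inside the tensor algebra. *)
Definition tpow (n : nat) : set tensalg :=
  span [set tens w | w in [set w : seq L | size w = n]].

(* The map t; indices run from 0, so the sign (-1)^(i-1) becomes (-1)^i. *)
Definition tword (w : seq L) : tensalg :=
  \sum_(i < size w) (-1) ^+ i *: tens (nth 0 w i :: take i w ++ drop i.+1 w).

Definition tmap : tensalg -> tensalg := lift tword.

Lemma tword_multilinear : multilinear tword.
Proof.
move=> c a x y b; rewrite /tword.
rewrite !size_cat /= scaler_sumr -big_split /=; apply: eq_bigr => i _.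
rewrite scalerA mulrC -scalerA -scalerDr; congr (_ *: _).
rewrite !nth_cat !take_cat !drop_cat.
have [le_ia|le_ai] := ltnP i (size a).
  have [h|h] := ltnP i.+1 (size a).
    by rewrite -!cat_cons !catA tens_multilinear.
  have -> : i.+1 = size a by apply/eqP; rewrite eqn_leq le_ia h.
  by rewrite subnn /= -!cat_cons tens_multilinear.
have -> : (i.+1 < size a)%N = false by rewrite ltnNge (leq_trans le_ai).
rewrite subSn //; case: (i - size a)%N => [|j] /=.
  exact: (tens_multilinear _ [::]).
by rewrite -!catA !cat_cons -!cat_cons tens_multilinear.
Qed.

Lemma tmap_tens w : tmap (tens w) = tword w.
Proof. exact: (lift_tens tword_multilinear). Qed.

Lemma tmap_is_linear : linear tmap.
Proof. exact: lift_is_linear tword_multilinear. Qed.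

HB.instance Definition _ :=
  GRing.isLinear.Build k tensalg tensalg *:%R tmap tmap_is_linear.

Definition scommw (u v : seq L) : tensalg :=
  tens (u ++ v) - (-1) ^+ (size u * size v) *: tens (v ++ u).

Definition scomm : tensalg -> tensalg -> tensalg := lift2 scommw.

Lemma scommw_multilinearr u : multilinear (scommw u).
Proof.
move=> c a x y b; rewrite /scommw tcat_multilinearr tcat_multilinearl.
rewrite !size_cat /= scalerDr opprD addrACA scalerBr; congr (_ - _ + _).
by rewrite !scalerA mulrC.
Qed.

Lemma scommw_multilinearl v : multilinear (scommw^~ v).
Proof.
move=> c a x y b; rewrite /scommw tcat_multilinearr tcat_multilinearl.
rewrite !size_cat /= scalerDr opprD addrACA scalerBr; congr (_ - _ + _).
by rewrite !scalerA mulrC.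
Qed.

Lemma scomm_linearl V : linear (scomm^~ V).
Proof. exact: (lift2_linearl scommw_multilinearr scommw_multilinearl). Qed.

Lemma scomm_linearr U : linear (scomm U).
Proof. exact: (lift2_linearr scommw_multilinearr). Qed.

Lemma scommE n m U V : tpow n U -> tpow m V ->
  scomm U V = U * V - (-1) ^+ (n * m) *: (V * U).
Proof.
have sl0 W : scomm 0 W = 0.
  have := scomm_linearl W 1 0 0; rewrite !scale1r addr0 /= => h.
  by apply: (addrI (scomm 0 W)); rewrite -h addr0.
have sr0 W : scomm W 0 = 0.
  have := scomm_linearr W 1 0 0; rewrite !scale1r addr0 /= => h.
  by apply: (addrI (scomm W 0)); rewrite -h addr0.
move=> [s hs ->] [r hr ->].
elim: s hs => [|[c x] s ih] hs.
  by rewrite big_nil sl0 mul0r mulr0 scaler0 subr0.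
rewrite big_cons /= (scomm_linearl _ c) ih; last first.
  by move=> p ps; apply: hs; rewrite inE ps orbT.
rewrite mulrDl mulrDr scalerDr opprD addrACA; congr (_ + _).
rewrite -tensalg_scaleAl -tensalg_scaleAr scalerA mulrC -scalerA.
rewrite -scalerBr; congr (_ *: _).
have [u su] := hs (c, x) (mem_head _ _); rewrite /= => xE; subst x.
elim: r hr {ih hs} => [|[d y] r ih] hr.
  by rewrite big_nil sr0 mulr0 mul0r scaler0 subr0.
rewrite big_cons /= (scomm_linearr _ d) ih; last first.
  by move=> p pr; apply: hr; rewrite inE pr orbT.
rewrite mulrDl mulrDr scalerDr opprD addrACA; congr (_ + _).
rewrite -tensalg_scaleAl -tensalg_scaleAr scalerA mulrC -scalerA.
rewrite -scalerBr; congr (_ *: _).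
have [v sv] := hr (d, y) (mem_head _ _); rewrite /= => yE; subst y.
rewrite /scomm (lift2_tens scommw_multilinearr scommw_multilinearl) /scommw.
by rewrite !tensM /= su sv.
Qed.

Definition scommsub (A B : set tensalg) : set tensalg :=
  span [set scomm U V | U in A & V in B].

(* L, identified with its first tensor power. *)
Definition Lsub : set tensalg := [set tens [:: x] | x in [set: L]].

(* Lser i is L_(i+1). *)
Fixpoint Lser (i : nat) : set tensalg :=
  if i is j.+1 then scommsub Lsub (Lser j) else Lsub.

Definition gbar : set tensalg := sumsub (fun i => Lser i.+1).

Definition Psub : set tensalg :=
  span [set tens [:: x; x] | x in [set: L]].

Definition hsub : set tensalg := addsub gbar Psub.

Definition mulsub (A B : set tensalg) : set tensalg :=
  span [set a * b | a in A & b in B].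

Fixpoint powsub (U : set tensalg) (i : nat) : set tensalg :=
  if i is j.+1 then mulsub U (powsub U j)
  else [set c *: (1 : tensalg) | c in [set: k]].

Definition starsub (U : set tensalg) : set tensalg := sumsub (powsub U).

End TensorAlgebra.

Arguments hsub {k} L.
Arguments tmap {k L}.

(* Main.v *)
(* Write H for the algebra generated by h.  That H is killed by t follows     *)
(* from t(U V) = t(U) V for V in Ker t and from t([x, V]) = 0 for x in L and  *)
(* homogeneous V in Ker t.                                                    *)
(* For the converse, let e_1, ..., e_n be distinct basis elements of L, and   *)
(* set M_0 = H and M_r = M_(r-1) + e_r M_(r-1).  Since h e is contained in    *)
(* e h + h, while e e and e e' + e' e lie in h, the module M_n is stable      *)
(* under left multiplication by h and by e_1, ..., e_n, so that every tensor  *)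
(* lies in M_n for a suitable choice of the e_i.                              *)
(* Let f be the coordinate functional at e_n.  Then D = (f (x) id) o t        *)
(* satisfies D(x W) = f(x) W - x D(W), hence kills M_(n-1).  If A + e_n B is  *)
(* in Ker t with A and B in M_(n-1), applying D gives B = 0, and one          *)
(* concludes by induction on n.                                               *)

From HB Require Import structures.
Require Import Defs.
From mathcomp Require Import all_boot all_algebra.
From mathcomp Require Import boolp classical_sets.

Set Implicit Arguments.
Unset Strict Implicit.
Unset Printing Implicit Defensive.

Import GRing.Theory.
Local Open Scope ring_scope.
Local Open Scope classical_set_scope.

Local Notation span := Defs.span.
Local Notation lift := Defs.lift.

(** Letters are odd: h contains every x x and every x y + y x, and h x lies in x h + h
    ([hsub_swap]). So over H the letters behave as in an exterior algebra: every tensor is a sum of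
    square-free ordered products of basis letters, each followed by a factor in H
    ([ordered_exhaust]). Since t kills H ([tmap_starsub]), the superderivation [sderiv] contracts
    letters and passes over the factor in H. On Ker t all these contractions vanish, which removes
    the letters one at a time until only H is left ([ordered_ker]). Freeness of L supplies the
    finite lists of letters and, for each letter, a functional that is 1 on it and 0 on the others
    ([basis_coord]). *)

Section Submodule.
Context {k : comPzRingType} {M : lmodType k}.
Implicit Types (A N : set M) (F : nat -> set M).

(** * Submodules, spans, sums and coordinates in a basis *)

Definition is_submod A : Prop :=
  A 0 /\ forall (c : k) x y, A x -> A y -> A (c *: x + y).

Lemma submodD A x y : is_submod A -> A x -> A y -> A (x + y).
Proof. by move=> [_ h] Ax Ay; have := h 1 x y Ax Ay; rewrite scale1r. Qed.

Lemma submodZ A c x : is_submod A -> A x -> A (c *: x).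
Proof. by move=> [A0 h] Ax; have := h c x 0 Ax A0; rewrite addr0. Qed.

Lemma submodB A x y : is_submod A -> A x -> A y -> A (x - y).
Proof.
by move=> hA Ax Ay; rewrite -scaleN1r; apply: submodD => //; exact: submodZ.
Qed.

Lemma submod_sum A (I : eqType) (s : seq I) (f : I -> M) : is_submod A ->
  (forall i, i \in s -> A (f i)) -> A (\sum_(i <- s) f i).
Proof.
move=> hA; elim: s => [|i s ih] Af; first by rewrite big_nil; case: hA.
rewrite big_cons; apply: submodD => //; first by apply: Af; rewrite mem_head.
by apply: ih => j js; apply: Af; rewrite inE js orbT.
Qed.

Lemma span_submod A : is_submod (span A).
Proof.
split=> [|c x y [s hs ->] [r hr ->]]; first by exists [::]; rewrite ?big_nil.
exists ([seq (c * p.1, p.2) | p <- s] ++ r).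
  move=> p; rewrite mem_cat => /orP[/mapP[q qs ->]|]; last exact: hr.
  exact: hs qs.
rewrite big_cat big_map scaler_sumr; congr (_ + _).
by apply: eq_bigr => p _; rewrite scalerA.
Qed.

Lemma sub_span A x : A x -> span A x.
Proof.
move=> Ax; exists [:: (1, x)]; last by rewrite big_seq1 scale1r.
by move=> p; rewrite inE => /eqP->.
Qed.

Lemma span_le A N : is_submod N -> (forall x, A x -> N x) ->
  forall x, span A x -> N x.
Proof.
move=> hN AN x [s hs ->]; apply: submod_sum => // p ps.
by apply: submodZ => //; apply: AN; exact: hs.
Qed.

Lemma sumsub_submod F : (forall i, is_submod (F i)) -> is_submod (sumsub F).
Proof.
move=> hF; split=> [|c x y [n [f [Ff ->]]] [m [g [Fg ->]]]].
  by exists 0%N, (fun=> 0); split; [move=> i; case: (hF i)|rewrite big_ord0].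
(* The two sums may have different lengths, so both families are extended by zero up to the larger
   bound. *)
pose pad l (h : nat -> M) i := if (i < l)%N then h i else 0.
have padF l h : (forall i, F i (h i)) -> forall i, F i (pad l h i).
  by move=> Fh i; rewrite /pad; case: ifP => // _; case: (hF i).
have padE l (h : nat -> M) q : (l <= q)%N ->
    \sum_(i < l) h i = \sum_(i < q) pad l h i.
  by move=> lq; rewrite (big_ord_widen q h lq) big_mkcond.
exists (maxn n m), (fun i => c *: pad n f i + pad m g i); split.
  move=> i; case: (hF i) => _; apply; exact: padF.
rewrite (padE n f (maxn n m)) ?leq_maxl //.
by rewrite (padE m g (maxn n m)) ?leq_maxr // scaler_sumr -big_split.
Qed.

Lemma sub_sumsub F i x : (forall j, is_submod (F j)) -> F i x -> sumsub F x.
Proof.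
move=> hF Fx; exists i.+1, (fun j => if j == i then x else 0); split.
  by move=> j; case: eqP => [->|_] //; case: (hF j).
rewrite big_ord_recr /= eqxx big1 ?add0r // => j _.
by rewrite ltn_eqF.
Qed.

Lemma sumsub_le F N : is_submod N -> (forall i x, F i x -> N x) ->
  forall x, sumsub F x -> N x.
Proof.
move=> hN FN x [n [f [Ff ->]]].
by apply: submod_sum => // i _; exact: FN.
Qed.

Lemma addsub_submod A N : is_submod A -> is_submod N -> is_submod (addsub A N).
Proof.
move=> [A0 hA] [N0 hN]; split.
  by exists 0 => //; exists 0; rewrite ?addr0.
move=> c _ _ [a Aa [b Nb <-]] [a' Aa' [b' Nb' <-]].
exists (c *: a + a'); first exact: hA.
by exists (c *: b + b'); [exact: hN|rewrite scalerDr addrACA].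
Qed.

(** The functional reads off the coefficient of b in a chosen expansion of x over the basis; linear
    independence makes it independent of the choice, hence linear. *)
Lemma basis_coord (B : set M) b : is_basis B -> B b ->
  exists f : M -> k, [/\ forall c x y, f (c *: x + y) = c * f x + f y,
    f b = 1 & forall x, B x -> x != b -> f x = 0].
Proof.
move=> [Bspan Bfree] Bb.
pose inB (s : seq (k * M)) := forall p, p \in s -> B p.2.
pose ev (s : seq (k * M)) := \sum_(p <- s) p.1 *: p.2.
pose cf x (s : seq (k * M)) := \sum_(p <- s | p.2 == x) p.1.
pose sc c (s : seq (k * M)) := [seq (c * p.1, p.2) | p <- s].
have inB_sc c s : inB s -> inB (sc c s).
  by move=> hs p /mapP[q qs ->]; exact: hs qs.
have inB_cat s r : inB s -> inB r -> inB (s ++ r).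
  by move=> hs hr p; rewrite mem_cat => /orP[/hs|/hr].
have ev_sc c s : ev (sc c s) = c *: ev s.
  rewrite /ev big_map scaler_sumr.
  by apply: eq_bigr => p _; rewrite scalerA.
have cf_sc x c s : cf x (sc c s) = c * cf x s.
  by rewrite /cf big_map mulr_sumr.
have ev_cat s r : ev (s ++ r) = ev s + ev r by rewrite /ev big_cat.
have cf_cat x s r : cf x (s ++ r) = cf x s + cf x r by rewrite /cf big_cat.
(* A vector may occur several times in s; [cf] collects its coefficients, so that independence
   applies to the duplicate-free list of vectors. *)
have cf0 s : inB s -> ev s = 0 -> cf b s = 0.
  move=> hs ev0; have [bs|bs] := boolP (b \in undup [seq p.2 | p <- s]).
    apply: (Bfree (undup [seq p.2 | p <- s]) (cf^~ s)) bs.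
    - exact: undup_uniq.
    - by move=> x; rewrite mem_undup => /mapP[p ps ->]; exact: hs.
    transitivity (ev s) => //; rewrite /ev /cf.
    under eq_bigr do rewrite scaler_suml big_mkcond.
    rewrite exchange_big /= big_seq [RHS]big_seq; apply: eq_bigr => p ps.
    rewrite (bigD1_seq p.2) ?undup_uniq ?mem_undup ?map_f //= eqxx.
    by rewrite big1 ?addr0 // => x xp; rewrite eq_sym (negbTE xp).
  rewrite /cf big_seq_cond big1 // => p /andP[ps /eqP pb].
  by rewrite -pb mem_undup map_f in bs.
have cf_eq s r : inB s -> inB r -> ev s = ev r -> cf b s = cf b r.
  move=> hs hr e; apply/eqP; rewrite -subr_eq0; apply/eqP.
  have /cf0 : inB (s ++ sc (-1) r) by apply: inB_cat => //; exact: inB_sc.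
  by rewrite ev_cat cf_cat ev_sc cf_sc e scaleN1r mulN1r subrr; apply.
have repB x : exists s, inB s /\ ev s = x.
  have : span B x by rewrite Bspan.
  by move=> [s hs ->]; exists s.
have [rep hrep] := choice repB.
have repE s : inB s -> cf b (rep (ev s)) = cf b s.
  by move=> hs; case: (hrep (ev s)) => h1 h2; exact: cf_eq.
have rep1 x : B x -> cf b (rep x) = (x == b)%:R.
  move=> Bx; have ex : ev [:: (1, x)] = x by rewrite /ev big_seq1 scale1r.
  rewrite -{1}ex repE; last by move=> p; rewrite inE => /eqP->.
  by rewrite /cf big_cons big_nil /= addr0; case: (x == b).
exists (fun x => cf b (rep x)); split.
- move=> c x y; have [hx ex] := hrep x; have [hy ey] := hrep y.
  have <- : ev (sc c (rep x) ++ rep y) = c *: x + y.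
    by rewrite ev_cat ev_sc ex ey.
  by rewrite repE ?cf_cat ?cf_sc //; apply: inB_cat => //; exact: inB_sc.
- by rewrite rep1 // eqxx.
- by move=> x Bx /negbTE xb; rewrite rep1 // xb.
Qed.

Lemma basis_finite_span (B : set M) (s : seq M) : is_basis B ->
  exists E : seq M, [/\ uniq E, forall e, e \in E -> B e &
    forall x, x \in s -> span [set e | e \in E] x].
Proof.
move=> [Bspan _]; elim: s => [|x s [E [_ EB Es]]]; first by exists [::].
have : span B x by rewrite Bspan.
move=> [r rB xE]; exists (undup ([seq p.2 | p <- r] ++ E)); split.
- exact: undup_uniq.
- move=> e; rewrite mem_undup mem_cat => /orP[/mapP[p pr ->]|/EB//].
  exact: rB.
move=> y; rewrite inE => /orP[/eqP->|/Es ys].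
  exists r => // p pr /=.
  by rewrite mem_undup mem_cat map_f.
apply: span_le ys; first exact: span_submod.
by move=> e /= eE; apply: sub_span; rewrite /= mem_undup mem_cat eE orbT.
Qed.

End Submodule.

Section TensorAlgebra.
Context {k : comPzRingType} {L : lmodType k}.
Local Notation T := (tensalg L).
Local Notation "[ 't' x ]" := (tens [:: x] : T) (x at level 200).
Implicit Types (x y : L) (u w : seq L) (a b V : T) (A N : set T).

(** * The subalgebra generated by h, and induction principles for it *)

Lemma lmul_submod a N : is_submod N -> is_submod [set b | N (a * b)].
Proof.
move=> [N0 hN]; split=> [|c x y /= Nx Ny]; first by rewrite /= mulr0.
by rewrite mulrDr -tensalg_scaleAr; exact: hN.
Qed.

Lemma rmul_submod N A : is_submod N ->
  is_submod [set a | forall b, A b -> N (a * b)].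
Proof.
move=> [N0 hN]; split=> [b _|c x y /= Nx Ny b Ab]; first by rewrite mul0r.
by rewrite mulrDl -tensalg_scaleAl; apply: hN; [exact: Nx|exact: Ny].
Qed.

Lemma powsub_submod (U : set T) i : is_submod (powsub U i).
Proof.
case: i => [|i]; last exact: span_submod.
split; first by exists 0 => //; rewrite scale0r.
move=> c _ _ [d _ <-] [e _ <-]; exists (c * d + e) => //.
by rewrite scalerDl scalerA.
Qed.

Lemma starsub_submod (U : set T) : is_submod (starsub U).
Proof. by apply: sumsub_submod => i; exact: powsub_submod. Qed.

Lemma starsub1 (U : set T) : starsub U 1.
Proof.
apply: (@sub_sumsub _ _ _ 0%N); first exact: powsub_submod.
by exists 1 => //; rewrite scale1r.
Qed.

Lemma starsub_lmul (U : set T) a b : U a -> starsub U b -> starsub U (a * b).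
Proof.
move=> Ua; apply: (@sumsub_le _ _ _ [set b | starsub U (a * b)]).
  exact: lmul_submod (starsub_submod U).
move=> i c hc; apply: (@sub_sumsub _ _ _ i.+1); first exact: powsub_submod.
by apply: sub_span; exists a => //; exists c.
Qed.

Lemma starsub_le (U N : set T) : is_submod N -> N 1 ->
  (forall a b, U a -> N b -> N (a * b)) -> forall a, starsub U a -> N a.
Proof.
move=> hN N1 UN; apply: sumsub_le => //; elim=> [|i ih].
  by move=> _ [c _ <-]; exact: submodZ.
apply: span_le => // _ [a Ua [b hb <-]]; apply: UN => //; exact: ih.
Qed.

Lemma Lser_submod i : is_submod (@Lser k L i.+1).
Proof. exact: span_submod. Qed.

Lemma gbar_submod : is_submod (@gbar k L).
Proof. by apply: sumsub_submod => i; exact: Lser_submod. Qed.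

Lemma hsub_submod : is_submod (hsub L).
Proof. by apply: addsub_submod; [exact: gbar_submod|exact: span_submod]. Qed.

Lemma hsub_Lser i a : Lser i.+1 a -> hsub L a.
Proof.
move=> La; exists a.
  by apply: (@sub_sumsub _ _ _ i) => // j; exact: Lser_submod.
exists 0; rewrite ?addr0 //.
by case: (span_submod [set tens [:: x; x] | x in [set: L]]).
Qed.

Lemma hsub_sq x : hsub L (tens [:: x; x]).
Proof.
exists 0; first by case: gbar_submod.
by exists (tens [:: x; x]); rewrite ?add0r //; apply: sub_span; exists x.
Qed.

Lemma hsub_le N : is_submod N -> (forall i a, Lser i.+1 a -> N a) ->
  (forall x, N (tens [:: x; x])) -> forall a, hsub L a -> N a.
Proof.
move=> hN LN PN _ [a ga [b Pb <-]]; apply: submodD => //.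
  exact: sumsub_le ga.
by apply: span_le Pb => // _ [x _ <-].
Qed.

(** * Supercommutators with a letter, and moving letters to the left past h *)

Lemma tpow_tens w : tpow (size w) (tens w : T).
Proof. by apply: sub_span; exists w. Qed.

Lemma scomm_letter n x V : tpow n V ->
  scomm [t x] V = [t x] * V - (-1) ^+ n *: (V * [t x]).
Proof. by move=> hV; rewrite (scommE (tpow_tens [:: x]) hV) mul1n. Qed.

Lemma tpow_letterl n x V : tpow n V -> tpow n.+1 ([t x] * V).
Proof.
apply: (@span_le _ _ _ [set V | tpow n.+1 ([t x] * V)]).
  exact: lmul_submod (span_submod _).
by move=> _ [w /= <- <-]; rewrite tensM; exact: tpow_tens (x :: w).
Qed.

Lemma tpow_letterr n x V : tpow n V -> tpow n.+1 (V * [t x]).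
Proof.
move=> hV; suff : [set V | forall b, b = [t x] -> tpow n.+1 (V * b)] V.
  exact.
apply: (span_le _ _ hV).
  exact: (@rmul_submod _ [set b | b = [t x]] (span_submod _)).
move=> _ [w /= <- <-] _ ->; rewrite tensM.
by have := tpow_tens (w ++ [:: x]); rewrite size_cat addn1.
Qed.

Lemma Lser_tpow i a : Lser i a -> tpow i.+1 a.
Proof.
elim: i a => [|i ih] a.
  by move=> [x _ <-]; exact: (tpow_tens [:: x]).
apply: span_le; first exact: span_submod.
move=> _ [_ [x _ <-] [V /ih hV <-]]; rewrite (scomm_letter _ hV).
apply: submodB; [exact: span_submod|exact: tpow_letterl|].
by apply: submodZ; [exact: span_submod|exact: tpow_letterr].
Qed.

Lemma Lser_scomm i x V : Lser i V -> Lser i.+1 (scomm [t x] V).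
Proof. by move=> hV; apply: sub_span; exists [t x]; [exists x|exists V]. Qed.

Lemma scomm_letters x y :
  scomm [t x] [t y] = tens [:: x; y] + tens [:: y; x].
Proof.
by rewrite (scomm_letter _ (tpow_tens [:: y])) !tensM expr1 scaleN1r opprK.
Qed.

(** V is homogeneous of degree i + 1, so [x, V] = x V - (-1)^(i+1) V x can be solved for V x; the
    error term is a multiple of [x, V]. *)
Lemma Lser_swap i V x : Lser i V ->
  exists2 W, Lser i.+1 W & V * [t x] = (-1) ^+ i.+1 *: ([t x] * V) + W.
Proof.
move=> hV; exists (- (-1) ^+ i.+1 *: scomm [t x] V).
  by apply: submodZ; [exact: Lser_submod|exact: Lser_scomm].
rewrite (scomm_letter _ (Lser_tpow hV)) scaleNr scalerBr scalerA -expr2.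
by rewrite sqrr_sign scale1r opprB addrC subrK.
Qed.

Lemma hsub_letters x y : hsub L (tens [:: x; y] + tens [:: y; x]).
Proof.
rewrite -scomm_letters; apply: (@hsub_Lser 0%N); apply: Lser_scomm.
by exists y.
Qed.

(* In the tensor algebra, [xx, y] = xxy - yxx = [x, [x, y]]. *)
Lemma sq_swap x y :
  exists2 W, Lser 2 W & tens [:: x; x] * [t y] = [t y] * tens [:: x; x] + W.
Proof.
exists (scomm [t x] (scomm [t x] [t y])).
  by do 2!apply: Lser_scomm; exists y.
have hxy : Lser 1 (scomm [t x] [t y]) by apply: Lser_scomm; exists y.
rewrite (scomm_letter _ (Lser_tpow hxy)) scomm_letters sqrrN expr1n scale1r.
rewrite mulrDr mulrDl !tensM /= opprD.
by rewrite [X in _ = _ + X]addrA addrK addrCA subrr addr0.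
Qed.

(** Checked on the generators of h by [Lser_swap] and [sq_swap]. In general V' differs from V, since
    the sign depends on the degree of each homogeneous part. *)
Lemma hsub_swap V x : hsub L V ->
  exists V' W, [/\ hsub L V', hsub L W & V * [t x] = [t x] * V' + W].
Proof.
move: V; pose N := [set V : T | exists V' W,
  [/\ hsub L V', hsub L W & V * [t x] = [t x] * V' + W]].
have [h0 hD] := hsub_submod.
apply: (@hsub_le N) => [|i V hV|y].
- split=> [|c a b [V [W [hV hW eV]]] [V' [W' [hV' hW' eV']]]].
    by exists 0, 0; split; rewrite // mul0r mulr0 addr0.
  exists (c *: V + V'), (c *: W + W'); split; try exact: hD.
  rewrite mulrDl -tensalg_scaleAl eV eV' scalerDr addrACA.
  by rewrite mulrDr -tensalg_scaleAr.
- have [W hW eW] := Lser_swap x hV; exists ((-1) ^+ i.+2 *: V), W.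
  split; last by rewrite eW -tensalg_scaleAr.
    by apply: submodZ; [exact: hsub_submod|exact: hsub_Lser hV].
  exact: hsub_Lser hW.
have [W hW eW] := sq_swap y x; exists (tens [:: y; y]), W; split=> //.
  exact: hsub_sq.
exact: hsub_Lser hW.
Qed.

(** * Normal form of tensors as ordered products of letters over H *)

(** The sum of all e H, where e runs over the products of subsequences of [E]. The head of the list
    is the letter adjoined last, and it stands leftmost. *)
Fixpoint ordered (E : seq L) : set T :=
  if E is e :: E' then addsub (ordered E') [set [t e] * m | m in ordered E']
  else starsub (hsub L).

Lemma ordered_submod E : is_submod (ordered E).
Proof.
elim: E => [|e E ih] /=; first exact: starsub_submod.
apply: addsub_submod => //; case: ih => h0 h; split.
  by exists 0; rewrite ?mulr0.
move=> c _ _ [a Ea <-] [b Eb <-]; exists (c *: a + b); first exact: h.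
by rewrite mulrDr -tensalg_scaleAr.
Qed.

Lemma ordered_tail e E a : ordered E a -> ordered (e :: E) a.
Proof.
move=> Ea; exists a => //; exists 0; rewrite ?addr0 //.
by exists 0; [case: (ordered_submod E)|rewrite mulr0].
Qed.

Lemma ordered_head e E a : ordered E a -> ordered (e :: E) ([t e] * a).
Proof.
move=> Ea; exists 0; first by case: (ordered_submod E).
by exists ([t e] * a); rewrite ?add0r //; exists a.
Qed.

Lemma ordered1 E : ordered E 1.
Proof. by elim: E => [|e E ih]; [exact: starsub1|exact: ordered_tail]. Qed.

Lemma ordered_hsub E a b : hsub L a -> ordered E b -> ordered E (a * b).
Proof.
elim: E a b => [|e E ih] a b ha; first exact: starsub_lmul.
move=> [b' Eb' [_ [c Ec <-] <-]]; rewrite mulrDr.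
apply: submodD; first exact: ordered_submod.
  by apply: ordered_tail; exact: ih.
have [V [W [hV hW eV]]] := hsub_swap e ha.
rewrite mulrA eV mulrDl -mulrA; apply: submodD; first exact: ordered_submod.
  by apply: ordered_head; exact: ih.
by apply: ordered_tail; exact: ih.
Qed.

(** Only e f c with f the head letter needs work: it is rewritten until f is leftmost or e f is
    absorbed into h. *)
Lemma ordered_letter E e b : e \in E -> ordered E b -> ordered E ([t e] * b).
Proof.
elim: E e b => [//|f E ih] e b; rewrite inE => eE [b' Eb' [_ [c Ec <-] <-]].
rewrite mulrDr; apply: submodD; first exact: ordered_submod.
  have [->|ef] := eqVneq e f; first exact: ordered_head.
  by apply: ordered_tail; apply: ih => //; rewrite (negbTE ef) in eE.
rewrite mulrA tensM cat1s; have [<-|ef] := eqVneq e f.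
  by apply: ordered_tail; apply: ordered_hsub => //; exact: hsub_sq.
rewrite (negbTE ef) /= in eE.
(* Distinct letters are reordered by e f = (e f + f e) - f e, with the anticommutator in h. *)
have -> : tens [:: e; f] =
    tens [:: e; f] + tens [:: f; e] - tens [:: f; e] :> T by rewrite addrK.
rewrite mulrBl.
apply: submodB; first exact: ordered_submod.
  by apply: ordered_tail; apply: ordered_hsub => //; exact: hsub_letters.
have -> : tens [:: f; e] = [t f] * [t e] by rewrite tensM.
by rewrite -mulrA; apply: ordered_head; exact: ih.
Qed.

Lemma tens0 : [t 0] = 0.
Proof. exact: (multilinear0 (@tens_multilinear k L) [::] [::]). Qed.

Lemma tens_letterP c x y : [t c *: x + y] = c *: [t x] + [t y].
Proof. exact: (@tens_multilinear k L c [::] x y [::]). Qed.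

Lemma ordered_letter_span E x b : span [set e | e \in E] x ->
  ordered E b -> ordered E ([t x] * b).
Proof.
move=> hx Eb; move: x hx.
apply: (@span_le _ _ _ [set x | ordered E ([t x] * b)]).
  split=> [|c x y /= hx hy].
    by rewrite /= tens0 mul0r; case: (ordered_submod E).
  rewrite tens_letterP mulrDl -tensalg_scaleAl.
  by case: (ordered_submod E) => _; apply.
by move=> e eE; exact: ordered_letter.
Qed.

Lemma ordered_tens E w : (forall x, x \in w -> span [set e | e \in E] x) ->
  ordered E (tens w).
Proof.
elim: w => [_|x w ih hw]; first exact: ordered1.
have -> : tens (x :: w) = [t x] * tens w by rewrite tensM.
apply: ordered_letter_span; first by apply: hw; rewrite mem_head.
by apply: ih => y yw; apply: hw; rewrite inE yw orbT.
Qed.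

(** A representative of a involves finitely many elements of L, and these lie in the span of
    finitely many basis elements. *)
Lemma ordered_exhaust (B : set L) a : is_basis B ->
  exists E, [/\ uniq E, forall e, e \in E -> B e & ordered E a].
Proof.
move=> hB; have [E [uE EB Es]] :=
  basis_finite_span (flatten [seq p.2 | p <- repr a]) hB.
exists E; split=> //; rewrite -(cls_repr a) clsE.
apply: submod_sum => [|p pa]; first exact: ordered_submod.
apply: submodZ; first exact: ordered_submod.
apply: ordered_tens => x xp; apply: Es; apply/flattenP.
by exists p.2 => //; exact: map_f.
Qed.

(** * Product rules for t, and the inclusion of H in Ker t *)

(** Applied to t(V), this puts a prefix u back behind the letter that t has pulled to the front. No
    empty word occurs in t(V), so the default 0 is harmless. *)
Definition insw u w : T := if w is x :: w' then tens (x :: u ++ w') else 0.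

Lemma insw_multilinear u : multilinear (insw u).
Proof.
move=> c [|z a] x y b /=; first exact: (tens_multilinear _ [::]).
by rewrite !catA -!cat_cons tens_multilinear.
Qed.

Definition ins u : T -> T := lift (insw u).

Lemma ins_tens u w : ins u (tens w) = insw u w.
Proof. exact: lift_tens (insw_multilinear u) w. Qed.

HB.instance Definition _ u := GRing.isLinear.Build k T T *:%R (ins u)
  (lift_is_linear (insw_multilinear u)).

(** The letter pulled to the front comes either from u or from V; in the second case it crosses all
    of u, whence the sign. *)
Lemma tmap_word_mul u V :
  tmap (tens u * V) = tmap (tens u) * V + (-1) ^+ size u *: ins u (tmap V).
Proof.
elim/tensalg_ind: V => [|c w V ih].
  by rewrite !(mulr0, linear0, scaler0, addr0).
rewrite !mulrDr -!tensalg_scaleAr !linearP /= ih addrACA.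
congr (_ + _); rewrite -scalerDr; congr (_ *: _).
rewrite tensM !tmap_tens /tword size_cat big_split_ord; congr (_ + _).
  rewrite mulr_suml; apply: eq_bigr => i _.
  rewrite -tensalg_scaleAl tensM nth_cat take_cat drop_cat /= ltn_ord.
  have [//|le_ui] := ltnP i.+1 (size u); first by rewrite catA.
  have -> : i.+1 = size u by apply/eqP; rewrite eqn_leq le_ui ltn_ord.
  by rewrite subnn drop0 drop_size cats0.
rewrite (linear_sum (ins u)) scaler_sumr; apply: eq_bigr => i _.
rewrite linearZ /= ins_tens scalerA exprD nth_cat take_cat drop_cat /=.
rewrite !ltnNge leq_addr (leq_trans (leq_addr i _)) //= subSn ?leq_addr //.
by rewrite addKn catA.
Qed.

Lemma tmap_mul U V : tmap V = 0 -> tmap (U * V) = tmap U * V.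
Proof.
move=> V0; elim/tensalg_ind: U => [|c w U ih].
  by rewrite linear0 !mul0r linear0.
rewrite mulrDl -tensalg_scaleAl !linearP /= ih tmap_word_mul V0 !linear0.
by rewrite addr0 mulrDl tensalg_scaleAl.
Qed.

Lemma tmap_letter x : tmap [t x] = [t x].
Proof. by rewrite tmap_tens /tword big_ord_recl big_ord0 scale1r addr0. Qed.

Lemma tmap_letter_mul x V : tmap ([t x] * V) = [t x] * V - ins [:: x] (tmap V).
Proof. by rewrite tmap_word_mul tmap_letter expr1 scaleN1r. Qed.

Lemma tmap_mul_letter n V x : tpow n V ->
  tmap (V * [t x]) = tmap V * [t x] + (-1) ^+ n *: ([t x] * V).
Proof.
pose N := [set V : T |
  tmap (V * [t x]) = tmap V * [t x] + (-1) ^+ n *: ([t x] * V)].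
move=> hV; suff : N V by [].
apply: span_le hV.
  split=> [|c U W /= hU hW].
    by rewrite /N /= !(mul0r, mulr0, linear0, scaler0, addr0).
  rewrite /N /= mulrDl mulrDr -tensalg_scaleAl -tensalg_scaleAr.
  rewrite [LHS]linearP /= hU hW [tmap (c *: U + W)]linearP /= mulrDl.
  rewrite -tensalg_scaleAl !scalerDr !scalerA addrACA.
  by rewrite [(-1) ^+ n * c]mulrC.
move=> _ [w /= wn <-]; rewrite /N /= -wn.
by rewrite tmap_word_mul tmap_letter ins_tens /= cats0 tensM.
Qed.

Lemma tmap_ker_submod : is_submod [set V : T | tmap V = 0].
Proof.
split=> [|c x y /= hx hy]; first by rewrite /= linear0.
by rewrite linearP /= hx hy scaler0 addr0.
Qed.

(** Here t(x V) = x V and t(V x) = (-1)^n x V, so the two terms cancel. *)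
Lemma tmap_scomm_ker n x V : tpow n V -> tmap V = 0 ->
  tmap (scomm [t x] V) = 0.
Proof.
move=> hV V0; rewrite (scomm_letter _ hV) linearB linearZ /=.
rewrite tmap_letter_mul (tmap_mul_letter _ hV) V0 mul0r add0r linear0 subr0.
by rewrite scalerA -expr2 sqrr_sign scale1r subrr.
Qed.

Lemma tmap_Lser i V : Lser i.+1 V -> tmap V = 0.
Proof.
elim: i V => [|i ih] V; apply: (span_le tmap_ker_submod).
  (* A letter is fixed by t, not killed, so the induction starts at [x, y] = x y + y x, where t(x y)
     = x y - y x is antisymmetric in x and y. *)
  move=> _ [_ [x _ <-] [_ [y _ <-] <-]]; rewrite /= scomm_letters.
  have E (a b : L) : tens [:: a; b] = [t a] * [t b] by rewrite tensM.
  rewrite !E linearD /= !tmap_letter_mul !tmap_letter !ins_tens /= !E.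
  by rewrite addrACA -opprD [X in _ - X]addrC subrr.
move=> _ [_ [x _ <-] [W hW <-]].
exact: (tmap_scomm_ker x (@Lser_tpow i.+1 W hW) (ih W hW)).
Qed.

Lemma tmap_hsub V : hsub L V -> tmap V = 0.
Proof.
apply: (hsub_le tmap_ker_submod) => [|x]; first exact: tmap_Lser.
have -> : tens [:: x; x] = [t x] * [t x] by rewrite tensM.
by rewrite /= tmap_letter_mul tmap_letter ins_tens /= tensM subrr.
Qed.

Lemma tmap_starsub V : starsub (hsub L) V -> tmap V = 0.
Proof.
apply: (starsub_le tmap_ker_submod) => [|a b ha hb].
  by rewrite /= tmap_tens /tword big_ord0.
by rewrite /= tmap_mul // tmap_hsub // mul0r.
Qed.

(** * Contraction of t against a linear functional *)

Section Contraction.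
Variable f : L -> k.
Hypothesis f_lin : forall c x y, f (c *: x + y) = c * f x + f y.

Definition contrw w : T := if w is x :: w' then f x *: tens w' else 0.

Lemma contrw_multilinear : multilinear contrw.
Proof.
move=> c [|z a] x y b /=; first by rewrite f_lin scalerDl scalerA.
by rewrite tens_multilinear scalerDr !scalerA mulrC.
Qed.

Lemma contr0 : lift contrw 0 = 0.
Proof. by have := lift_cls contrw_multilinear [::]; rewrite big_nil. Qed.

(* The superderivation (f (x) id) o t, which extends f. *)
Definition sderiv V : T := lift contrw (tmap V).

Lemma sderiv_linear : linear sderiv.
Proof.
by move=> c x y; rewrite /sderiv linearP (lift_is_linear contrw_multilinear).
Qed.

(** Once the first letter is contracted away, the inserted x stands in front. *)
Lemma contr_ins x V : lift contrw (ins [:: x] V) = [t x] * lift contrw V.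
Proof.
elim/tensalg_ind: V => [|c w V ih].
  by rewrite linear0 contr0 mulr0.
rewrite linearP /= !(lift_is_linear contrw_multilinear) mulrDr ih.
congr (_ + _); rewrite -tensalg_scaleAr ins_tens.
rewrite (lift_tens contrw_multilinear) /=; congr (_ *: _).
case: w => [|y w] /=; first by rewrite contr0 mulr0.
by rewrite (lift_tens contrw_multilinear) /= -tensalg_scaleAr tensM.
Qed.

Lemma sderiv_letter_mul x V : sderiv ([t x] * V) = f x *: V - [t x] * sderiv V.
Proof.
rewrite /sderiv tmap_letter_mul -contr_ins addrC -scaleN1r.
rewrite (lift_is_linear contrw_multilinear) scaleN1r addrC; congr (_ - _).
elim/tensalg_ind: V => [|c w V ih].
  by rewrite mulr0 scaler0 contr0.
rewrite mulrDr -tensalg_scaleAr tensM (lift_is_linear contrw_multilinear) ih.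
by rewrite (lift_tens contrw_multilinear) /= scalerDr !scalerA mulrC.
Qed.

Lemma sderiv_ker V : tmap V = 0 -> sderiv V = 0.
Proof. by rewrite /sderiv => ->; exact: contr0. Qed.

(** H is killed because it lies in Ker t, and by the Leibniz rule each letter with f(e) = 0
    preserves vanishing. *)
Lemma sderiv_ordered E V : (forall e, e \in E -> f e = 0) ->
  ordered E V -> sderiv V = 0.
Proof.
elim: E V => [|e E ih] V fE; first by move=> /tmap_starsub; exact: sderiv_ker.
have fE' e' : e' \in E -> f e' = 0 by move=> h; apply: fE; rewrite inE h orbT.
move=> [a Ea [_ [b Eb <-] <-]]; rewrite -[a]scale1r sderiv_linear.
rewrite sderiv_letter_mul !ih // fE ?mem_head //.
by rewrite !(scale0r, scaler0, mulr0, subr0, addr0).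
Qed.

End Contraction.

Lemma ordered_ker (B : set L) E V : is_basis B -> uniq E ->
  (forall e, e \in E -> B e) -> ordered E V -> tmap V = 0 ->
  starsub (hsub L) V.
Proof.
move=> hB; elim: E V => [|e E ih] V //= /andP[eE uE] EB.
have EB' e' : e' \in E -> B e' by move=> h; apply: EB; rewrite inE h orbT.
move=> [a Ea [_ [b Eb <-] <-]] V0.
have [f [f_lin fe f0]] := basis_coord hB (EB e (mem_head _ _)).
have fE e' : e' \in E -> f e' = 0.
  by move=> h; apply: f0; [exact: EB'|apply: contraNneq eE => <-].
have := sderiv_ker f_lin V0.
rewrite -[a in LHS]scale1r sderiv_linear // sderiv_letter_mul //.
(* Both a and b are killed by the derivation, so its value on a + e b is f(e) b = b. *)
rewrite !(sderiv_ordered f_lin fE) // fe scaler0 add0r scale1r mulr0 subr0.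
by move=> b0; apply: ih => //; move: V0; rewrite b0 mulr0 addr0.
Qed.

End TensorAlgebra.

Unset Implicit Arguments.

Theorem theorem6p6 (k : comPzRingType) (L : lmodType k)
  (hL : is_free_module L) :
  starsub (hsub L) = [set x : tensalg L | tmap x = 0].
Proof.
case: hL => B hB; apply/seteqP; split=> V /=; first exact: tmap_starsub.
have [E [uE EB EV]] := ordered_exhaust V hB => V0.
exact: (ordered_ker hB uE EB EV V0).
Qed.
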